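(* Let $\Omega=\Omega(A)$ be a standard differential graded algebra over a field $k$, $0\neq\lambda\in k$, and let $\perp$ be a degree $-2$ bilinear map on $\Omega$ with $\omega\perp a=a\perp\omega=0$ for $a\in A$, $\omega\in\Omega$, and $$(-1)^{|\eta|}(\omega\eta)\perp\zeta+(\omega\perp\eta)\zeta=\omega\perp(\eta\zeta)+(-1)^{|\omega|+|\eta|}\omega(\eta\perp\zeta),\qquad\forall\omega,\eta,\zeta\in\Omega,$$ and $\delta$ a regular degree $-1$ linear map with $\delta(a\omega)-a\delta\omega=\mathrm da\perp\omega$ for all $a\in A$, $\omega\in\Omega$. Put $\Delta=\mathrm d\delta+\delta\mathrm d$ and $[\![\omega,\eta]\!]=L_\delta(\omega,\eta)+\omega\perp\mathrm d\eta-(-1)^{|\omega|}\mathrm d\omega\perp\eta-(-1)^{|\omega|}\mathrm d(\omega\perp\eta)$, and let $\tilde\Omega(A)$ be the corresponding central extension of $\Omega(A)$. Then $\tilde\Omega(A)$ has a further extension to a differential graded algebra $$\tilde{\tilde\Omega}(A)=\Omega(A)\oplus\Omega(A)\theta'\oplus\Omega(A)\mathrm d\theta'$$ with product and exterior derivative, for $\omega,\eta\in\Omega(A)$, $$\omega\cdot\eta=\omega\eta+\tfrac\lambda2(-1)^{|\omega|+|\eta|}[\![\omega,\eta]\!]\theta'-\tfrac\lambda2(-1)^{|\omega|}(\omega\perp\eta)\mathrm d\theta',$$ $$\mathrm d_\cdot\omega=\mathrm d\omega-\tfrac\lambda2(-1)^{|\omega|}(\Delta\omega)\theta'+\tfrac\lambda2(\delta\omega)\mathrm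 d\theta',$$ where $\mathrm d_\cdot\theta'=\mathrm d\theta'$, $\theta'^2=\theta'\mathrm d\theta'=(\mathrm d\theta')\theta'=0$ and $\theta'$ graded-commutes with all $\omega\in\Omega(A)$. Moreover $\tilde{\tilde\Omega}(A)\to\tilde\Omega(A)\to\Omega(A)$, successively setting $\mathrm d\theta'=0$ and $\theta'=0$, are surjections of differential graded algebras.
   Context: $k$ has characteristic $\ne2$. A DGA on $A$ is an associative graded algebra $\Omega=\oplus_{n\ge0}\Omega^n$ with $\Omega^0=A$ and a graded derivation $\mathrm d$ of degree $1$, $\mathrm d^2=0$. It is standard if $\Omega^1$ is spanned by elements $a\,\mathrm db$ and $\Omega$ is generated by degrees $0,1$. $L_\delta(\omega,\eta)=\delta(\omega\eta)-(\delta\omega)\eta-(-1)^{|\omega|}\omega\delta\eta$. A degree $-1$ linear map $\delta$ on $\Omega$ is regular if there are bimodule maps $\mathfrak i:\Omega^1\otimes_A\Omega^n\to\Omega^{n-1}$ and $\grave{\mathfrak i}:\Omega^n\otimes_A\Omega^1\to\Omega^{n-1}$ with $\delta(a\omega)=a\delta\omega+\mathfrak i_{\mathrm da}\omega$ and $\delta(\omega a)=(\delta\omega)a+\omega\grave{\mathfrak i}_{\mathrm da}$. The central extension $\tilde\Omega(A)$ is the DGA $\Omega(A)\oplus\Omega(A)\theta'$ with $\theta'$ of degree 1, $\theta'^2=0$, $\theta'\omega=(-1)^{|\omega|}\omega\theta'$, $\mathrm d_\cdot\theta'=0$, $\omega\cdot\eta=\omega\eta+\frac\lambda2(-1)^{|\omega|+|\eta|}[\![\omega,\eta]\!]\theta'$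 and $\mathrm d_\cdot\omega=\mathrm d\omega-\frac\lambda2(-1)^{|\omega|}(\Delta\omega)\theta'$ for $\omega,\eta\in\Omega(A)$. In $\tilde{\tilde\Omega}(A)$, $\mathrm d\theta'$ is a symbol of degree $2$ with $\mathrm d_\cdot(\mathrm d\theta')=0$, $(\mathrm d\theta')^2=0$, commuting with $\Omega(A)$, and $\omega\cdot\theta'=\omega\theta'$, $\omega\cdot\mathrm d\theta'=\omega\,\mathrm d\theta'$. *)

(* Defs.v *)
From mathcomp Require Import all_boot all_order all_algebra.

Set Implicit Arguments.
Unset Strict Implicit.
Unset Printing Implicit Defensive.

Import GRing.Theory.
Local Open Scope ring_scope.

(* The graded algebra is given internally: a k-algebra that is the direct sum
   of the subspaces [grade n].  The degree-0 part is identified with A through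
   the injective algebra morphism [dga_in]. *)
Record dga (k : fieldType) (A : algType k) := DGA {
  dga_sort :> algType k;
  grade : nat -> {pred dga_sort};
  grade_submod : forall n, submod_closed (grade n);
  grade_span : forall x : dga_sort, exists n (f : nat -> dga_sort),
    (forall i, f i \in grade i) /\ x = \sum_(i < n) f i;
  grade_indep : forall n (f : nat -> dga_sort), (forall i, f i \in grade i) ->
    \sum_(i < n) f i = 0 -> forall i, (i < n)%N -> f i = 0;
  grade_mul : forall m n (x y : dga_sort),
    x \in grade m -> y \in grade n -> x * y \in grade (m + n)%N;
  dga_in : {lrmorphism A -> dga_sort};
  dga_in_inj : injective dga_in;
  grade0P : forall x : dga_sort, x \in grade 0%N <-> exists a, x = dga_in a;
  dga_d : {linear dga_sort -> dga_sort};
  dga_d_deg : forall n (x : dga_sort), x \in grade n -> dga_d x \in grade n.+1;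
  dga_dd : forall x : dga_sort, dga_d (dga_d x) = 0;
  dga_leibniz : forall m (x y : dga_sort), x \in grade m ->
    dga_d (x * y) = dga_d x * y + (-1) ^+ m *: (x * dga_d y)
}.
Arguments grade {k A} _ _.
Arguments dga_in {k A _}.
Arguments dga_d {k A _}.

Section Dga.
Variables (k : fieldType) (A : algType k).
Implicit Types Omega E F : dga A.

(* The component of integer degree z, which is 0 for z < 0. *)
Definition gradez Omega (z : int) : {pred Omega} :=
  match z with
  | Posz n => grade Omega n
  | Negz _ => pred1 0
  end.
Arguments gradez : clear implicits.

Definition has_degree Omega (r : int) (f : Omega -> Omega) : Prop :=
  forall n x, x \in grade Omega n -> f x \in gradez Omega (n%:Z + r).

Definition has_degree2 Omega (r : int) (f : Omega -> Omega -> Omega) : Prop :=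
  forall m n x y, x \in grade Omega m -> y \in grade Omega n ->
  f x y \in gradez Omega ((m + n)%N%:Z + r).

(* Every element is a sum of products of elements of degrees 0 and 1; scalars
   lie in degree 0, so this is generation as a k-algebra. *)
Definition standard Omega : Prop :=
  (forall x, x \in grade Omega 1 -> exists n (a b : nat -> A),
     x = \sum_(i < n) dga_in (a i) * dga_d (dga_in (b i))) /\
  (forall x : Omega, exists s : seq (seq Omega),
     (forall t y, t \in s -> y \in t ->
        (y \in grade Omega 0) || (y \in grade Omega 1)) /\
     x = \sum_(t <- s) \prod_(y <- t) y).

(* f restricts to an A-bimodule map
   Omega^m (x)_A Omega^n -> Omega^(m+n-2), given as the corresponding
   A-balanced k-bilinear map on Omega^m x Omega^n; the values of f elsewhere
   are irrelevant. *)
Record tensor_bimodule_map Omega (m n : nat) (f : Omega -> Omega -> Omega) :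
    Prop := TensorBimoduleMap {
  tbm_deg : forall x y, x \in grade Omega m -> y \in grade Omega n ->
    f x y \in gradez Omega ((m + n)%N%:Z - 2);
  tbm_linl : forall (c : k) x x' y, x \in grade Omega m ->
    x' \in grade Omega m -> y \in grade Omega n ->
    f (c *: x + x') y = c *: f x y + f x' y;
  tbm_linr : forall (c : k) x y y', x \in grade Omega m ->
    y \in grade Omega n -> y' \in grade Omega n ->
    f x (c *: y + y') = c *: f x y + f x y';
  tbm_balanced : forall a x y, x \in grade Omega m -> y \in grade Omega n ->
    f (x * dga_in a) y = f x (dga_in a * y);
  tbm_left : forall a x y, x \in grade Omega m -> y \in grade Omega n ->
    f (dga_in a * x) y = dga_in a * f x y;
  tbm_right : forall a x y, x \in grade Omega m -> y \in grade Omega n ->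
    f x (y * dga_in a) = f x y * dga_in a
}.

Definition regular Omega (delta : Omega -> Omega) : Prop :=
  has_degree (-1) delta /\
  exists i i' : Omega -> Omega -> Omega, forall n,
    [/\ tensor_bimodule_map 1 n i,
        tensor_bimodule_map n 1 i',
        forall (a : A) w, w \in grade Omega n ->
          delta (dga_in a * w) = dga_in a * delta w + i (dga_d (dga_in a)) w
      & forall (a : A) w, w \in grade Omega n ->
          delta (w * dga_in a) = delta w * dga_in a + i' w (dga_d (dga_in a))].

(* In the next two definitions m stands for the degree of x. *)
Definition Lop Omega (f : Omega -> Omega) (m : nat) (x y : Omega) : Omega :=
  f (x * y) - f x * y - (-1) ^+ m *: (x * f y).

Definition bracket Omega (delta : Omega -> Omega)
    (perp : Omega -> Omega -> Omega) (m : nat) (x y : Omega) : Omega :=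
  Lop delta m x y + perp x (dga_d y) - (-1) ^+ m *: perp (dga_d x) y
  - (-1) ^+ m *: dga_d (perp x y).

Definition laplacian Omega (delta : Omega -> Omega) (x : Omega) : Omega :=
  dga_d (delta x) + delta (dga_d x).

(* Morphisms of DGAs on the same algebra A. *)
Record dga_morphism E F (f : {lrmorphism E -> F}) : Prop := DgaMorphism {
  dga_morphism_deg : forall n x, x \in grade E n -> f x \in grade F n;
  dga_morphism_in : forall a : A, f (dga_in a) = dga_in a;
  dga_morphism_d : forall x, f (dga_d x) = dga_d (f x)
}.

Definition dga_surjection E F (f : {lrmorphism E -> F}) : Prop :=
  dga_morphism f /\ (forall y, exists x, f x = y).

(* E is the vector space Omega (+) Omega theta' with the indicated product and
   differential.  The first summand is embedded by iota, which is linear but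
   not multiplicative, and w theta' stands for the product iota w * theta. *)
Record central_extension Omega (lambda : k)
    (br : nat -> Omega -> Omega -> Omega) (Delta : Omega -> Omega)
    E (iota : {linear Omega -> E}) (theta : E) : Prop := CentralExtension {
  ce_deg : forall n x, x \in grade Omega n -> iota x \in grade E n;
  ce_in : forall a : A, iota (dga_in a) = dga_in a;
  ce_theta_deg : theta \in grade E 1;
  ce_bij : bijective (fun p : Omega * Omega => iota p.1 + iota p.2 * theta);
  ce_theta_sq : theta * theta = 0;
  ce_theta_comm : forall m w, w \in grade Omega m ->
    theta * iota w = (-1) ^+ m *: (iota w * theta);
  ce_d_theta : dga_d theta = 0;
  ce_mul : forall m n w y, w \in grade Omega m -> y \in grade Omega n ->
    iota w * iota y =
      iota (w * y)
      + (lambda / 2 * (-1) ^+ (m + n)) *: (iota (br m w y) * theta);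
  ce_d : forall m w, w \in grade Omega m ->
    dga_d (iota w) =
      iota (dga_d w) - (lambda / 2 * (-1) ^+ m) *: (iota (Delta w) * theta)
}.

(* Likewise for Omega (+) Omega theta' (+) Omega dtheta', where dtheta' is the
   differential of theta' in E. *)
Record double_extension Omega (lambda : k)
    (br : nat -> Omega -> Omega -> Omega) (Delta : Omega -> Omega)
    (delta : Omega -> Omega) (perp : Omega -> Omega -> Omega)
    E (iota : {linear Omega -> E}) (theta : E) : Prop := DoubleExtension {
  de_deg : forall n x, x \in grade Omega n -> iota x \in grade E n;
  de_in : forall a : A, iota (dga_in a) = dga_in a;
  de_theta_deg : theta \in grade E 1;
  de_bij : bijective (fun p : Omega * Omega * Omega =>
    iota p.1.1 + iota p.1.2 * theta + iota p.2 * dga_d theta);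
  de_theta_sq : theta * theta = 0;
  de_theta_dtheta : theta * dga_d theta = 0;
  de_dtheta_theta : dga_d theta * theta = 0;
  de_dtheta_sq : dga_d theta * dga_d theta = 0;
  de_d_dtheta : dga_d (dga_d theta) = 0;
  de_theta_comm : forall m w, w \in grade Omega m ->
    theta * iota w = (-1) ^+ m *: (iota w * theta);
  de_dtheta_comm : forall w, dga_d theta * iota w = iota w * dga_d theta;
  de_mul : forall m n w y, w \in grade Omega m -> y \in grade Omega n ->
    iota w * iota y =
      iota (w * y)
      + (lambda / 2 * (-1) ^+ (m + n)) *: (iota (br m w y) * theta)
      - (lambda / 2 * (-1) ^+ m) *: (iota (perp w y) * dga_d theta);
  de_d : forall m w, w \in grade Omega m ->
    dga_d (iota w) =
      iota (dga_d w) - (lambda / 2 * (-1) ^+ m) *: (iota (Delta w) * theta)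
      + (lambda / 2) *: (iota (delta w) * dga_d theta)
}.

End Dga.

(* Main.v *)
From HB Require Import structures.
Require Import Defs.
From mathcomp Require Import all_boot all_order all_algebra.
From Stdlib Require Import IndefiniteDescription.

(** The extension is the square-zero extension of Omega by the bimodule
    M = Omega theta' (+) Omega dtheta', so that the DGA axioms reduce to a
    Hochschild cocycle condition for the M-component of the product and its
    compatibility with the M-component of the differential.  The dtheta' part of
    the cocycle is perp, and its cocycle condition is the four-term relation; the
    bracket is the coboundary of delta plus the commutator of d with perp, which
    is a cocycle for the same reason.  Compatibility with the differential is the
    definition of the bracket (dtheta' part) and its consequence obtained by
    applying d (theta' part).  Since all signs are of the form (-1)^degree, they
    are encoded by the parity involution s of Omega, which turns the conditions
    into identities in an algebra, valid without homogeneity assumptions. *)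

Set Implicit Arguments.
Unset Strict Implicit.
Unset Printing Implicit Defensive.

Import GRing.Theory.
Local Open Scope ring_scope.

(* The tactic [zmod] proves identities in an abelian group, such as the additive
   group of a noncommutative algebra, where [ring] is not available. *)
Inductive zexpr := ZVar of nat | ZZero | ZAdd of zexpr & zexpr | ZOpp of zexpr.

Fixpoint zeval (V : zmodType) (env : seq V) (e : zexpr) : V :=
  match e with
  | ZVar i => env`_i
  | ZZero => 0
  | ZAdd e1 e2 => zeval env e1 + zeval env e2
  | ZOpp e1 => - zeval env e1
  end.

Fixpoint zcoef (e : zexpr) (i : nat) : int :=
  match e with
  | ZVar j => (i == j)%:Z
  | ZZero => 0
  | ZAdd e1 e2 => zcoef e1 i + zcoef e2 i
  | ZOpp e1 => - zcoef e1 i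
  end.

(** The integer combination of atoms is the normal form on which the reflection rests. *)
Lemma zevalE (V : zmodType) (env : seq V) e :
  zeval env e = \sum_(i < size env) env`_i *~ zcoef e i.
Proof.
elim: e => [j||e1 IH1 e2 IH2|e1 IH1] /=.
- case: (ltnP j (size env)) => hj.
    rewrite (bigD1 (Ordinal hj)) //= eqxx big1 ?addr0 // => i ne_ij.
    by have /negPf -> : nat_of_ord i != j by [].
  (* An index outside [env] evaluates to the default value 0, and it matches no index of the sum. *)
  rewrite nth_default // big1 // => i _.
  by rewrite (ltn_eqF (leq_trans (ltn_ord i) hj)).
- by rewrite big1.
- by rewrite IH1 IH2 -big_split; apply: eq_bigr => i _; rewrite mulrzDr.
- by rewrite IH1 -sumrN; apply: eq_bigr => i _; rewrite mulrNz.
Qed.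

Lemma zeval_eq (V : zmodType) (env : seq V) e1 e2 :
  all (fun i => zcoef e1 i == zcoef e2 i) (iota 0 (size env)) ->
  zeval env e1 = zeval env e2.
Proof.
move=> /allP eq12; rewrite !zevalE; apply: eq_bigr => i _.
by rewrite (eqP (eq12 i _)) // mem_iota /=.
Qed.

(** The inner match on the goal runs [unify] while a term is being built, so atoms are identified up
    to unification and not only syntactically. *)
Ltac zmod_index x env :=
  lazymatch env with
  | ?y :: ?env' =>
    match constr:(tt) with
    | _ => let _ := match goal with _ => unify x y end in constr:(0%N)
    | _ => let i := zmod_index x env' in constr:(i.+1)
    end
  end.

Ltac zmod_atoms t env :=
  lazymatch t with
  | @GRing.add _ ?a ?b => let env' := zmod_atoms a env in zmod_atoms b env'
  | @GRing.opp _ ?a => zmod_atoms a env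
  | @GRing.zero _ => env
  | _ =>
    match constr:(tt) with
    | _ => let _ := zmod_index t env in env
    | _ => constr:(t :: env)
    end
  end.

Ltac zmod_reify t env :=
  lazymatch t with
  | @GRing.add _ ?a ?b =>
    let e1 := zmod_reify a env in
    let e2 := zmod_reify b env in constr:(ZAdd e1 e2)
  | @GRing.opp _ ?a => let e1 := zmod_reify a env in constr:(ZOpp e1)
  | @GRing.zero _ => constr:(ZZero)
  | _ => let i := zmod_index t env in constr:(ZVar i)
  end.

Ltac zmod :=
  lazymatch goal with
  | |- @eq ?T ?a ?b =>
    let env1 := zmod_atoms a constr:(@nil T) in
    let env := zmod_atoms b env1 in
    let e1 := zmod_reify a env in
    let e2 := zmod_reify b env in
    apply: (@zeval_eq _ env e1 e2); vm_compute; reflexivity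
  end.

(** * Graded vector spaces: uniqueness of components, the parity involution, degree shifts *)

Section Graded.
Variables (k : fieldType) (V : lmodType k).
Implicit Types (g : nat -> {pred V}) (f : nat -> V).

Record graded g : Prop := Graded {
  graded_submod : forall n, submod_closed (g n);
  graded_span : forall x, exists n f,
    (forall i, f i \in g i) /\ x = \sum_(i < n) f i;
  graded_indep : forall n f, (forall i, f i \in g i) ->
    \sum_(i < n) f i = 0 -> forall i, (i < n)%N -> f i = 0
}.

Variable g : nat -> {pred V}.
Hypothesis gr : graded g.

Lemma graded0 n : 0 \in g n.
Proof. by case: (graded_submod gr n). Qed.

Lemma gradedP n c x y : x \in g n -> y \in g n -> c *: x + y \in g n.
Proof. by case: (graded_submod gr n) => _; apply. Qed.

Lemma gradedD n x y : x \in g n -> y \in g n -> x + y \in g n.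
Proof. by rewrite -{2}[x]scale1r; apply: gradedP. Qed.

Lemma gradedZ n c x : x \in g n -> c *: x \in g n.
Proof. by rewrite -[_ *: _]addr0 => gx; apply: gradedP => //; apply: graded0. Qed.

Lemma gradedN n x : x \in g n -> - x \in g n.
Proof. by rewrite -scaleN1r; apply: gradedZ. Qed.

Lemma gradedB n x y : x \in g n -> y \in g n -> x - y \in g n.
Proof. by move=> gx gy; apply/gradedD/gradedN. Qed.

Lemma graded_sum n N (f : 'I_N -> V) : (forall i, f i \in g n) ->
  \sum_(i < N) f i \in g n.
Proof.
by move=> gf; apply: (big_ind (fun x => x \in g n)) => //;
  [apply: graded0 | move=> x y; apply: gradedD].
Qed.

Lemma sum_pad n N f : (n <= N)%N ->
  \sum_(i < n) f i = \sum_(i < N) (if (i < n)%N then f i else 0).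
Proof. by move=> le_nN; rewrite (big_ord_widen N f le_nN) big_mkcond. Qed.

Lemma pad_graded n f : (forall i, f i \in g i) ->
  forall i, (if (i < n)%N then f i else 0) \in g i.
Proof. by move=> gf i; case: ifP => // _; apply: graded0. Qed.

(** Components are unique once both families are padded to a common length, so scaling degree by
    degree is well defined. It serves with indicators for projections and with signs for the
    parity. *)
Lemma graded_scale_eq (c : nat -> k) n m f h :
  (forall i, f i \in g i) -> (forall i, h i \in g i) ->
  \sum_(i < n) f i = \sum_(i < m) h i ->
  \sum_(i < n) c i *: f i = \sum_(i < m) c i *: h i.
Proof.
move=> gf gh eq_fh; have gf' := pad_graded n gf; have gh' := pad_graded m gh.
rewrite (sum_pad (fun i => c i *: f i) (leq_addr m n)).
rewrite (sum_pad (fun i => c i *: h i) (leq_addl n m)).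
move: eq_fh; rewrite (sum_pad f (leq_addr m n)) (sum_pad h (leq_addl n m)).
move=> /eqP; rewrite -subr_eq0 -sumrB => /eqP eq0; apply: eq_bigr => i _.
have := graded_indep gr (fun j => gradedB (gf' j) (gh' j)) eq0 (ltn_ord i).
move=> /eqP; rewrite subr_eq0 => /eqP eq_i.
have pull (b : bool) (y : V) :
    (if b then c i *: y else 0) = c i *: (if b then y else 0).
  by case: b; rewrite ?scaler0.
by rewrite !pull eq_i.
Qed.

(* The projection to degree [n] scales the component of degree [i] by [i == n]. *)
Lemma graded_proj n N x f : (forall i, f i \in g i) -> x \in g n ->
  x = \sum_(i < N) f i -> x = \sum_(i < N) (i == n :> nat)%:R *: f i.
Proof.
move=> gf gx x_f; pose h i := if i == n then x else 0.
have gh i : h i \in g i by rewrite /h; case: eqP => [->|_] //; apply: graded0.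
have x_h : x = \sum_(i < n.+1) h i.
  rewrite big_ord_recr big1 /= => [|i _]; first by rewrite /h eqxx add0r.
  by rewrite /h ltn_eqF.
rewrite -(@graded_scale_eq (fun i => (i == n)%:R) n.+1 _ h) -?x_h //.
rewrite big_ord_recr big1 /= => [|i _]; first by rewrite /h eqxx add0r scale1r.
by rewrite /h ltn_eqF // scaler0.
Qed.

(** Decompositions exist only propositionally, so one is chosen for each vector; by
    [graded_scale_eq] the value of [s] does not depend on the choice, which yields linearity. *)
Lemma parity_exists :
  exists s : {linear V -> V}, forall n x, x \in g n -> s x = (-1) ^+ n *: x.
Proof.
pose dec x := constructive_indefinite_description _ (graded_span gr x).
pose dec2 x := constructive_indefinite_description _ (proj2_sig (dec x)).
pose N x := proj1_sig (dec x); pose c x := proj1_sig (dec2 x).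
have gc x i : c x i \in g i by case: (proj2_sig (dec2 x)) => gcx _; apply: gcx.
have xc x : x = \sum_(i < N x) c x i by case: (proj2_sig (dec2 x)).
pose s x := \sum_(i < N x) (-1) ^+ i *: c x i.
have sE x n f : (forall i, f i \in g i) -> x = \sum_(i < n) f i ->
    s x = \sum_(i < n) (-1) ^+ i *: f i.
  by move=> gf x_f; apply: graded_scale_eq; rewrite -?xc.
have s_lin : linear s.
  (* Both decompositions are padded with zeros to length [N x + N y], so that their combination
     decomposes [a *: x + y]. *)
  move=> a x y; pose p n z i := if (i < n)%N then c z i else 0.
  have gp n z i : p n z i \in g i by apply: pad_graded.
  have pE z M : (N z <= M)%N -> z = \sum_(i < M) p (N z) z i.
    by move=> leM; rewrite -sum_pad.
  have lex := leq_addr (N y) (N x); have ley := leq_addl (N x) (N y).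
  rewrite (sE x _ _ (gp _ x) (pE _ _ lex)) (sE y _ _ (gp _ y) (pE _ _ ley)).
  rewrite (sE (a *: x + y) (N x + N y)%N
    (fun i => a *: p (N x) x i + p (N y) y i)).
  - rewrite scaler_sumr -big_split; apply: eq_bigr => i _ /=.
    by rewrite scalerDr !scalerA [a * _]mulrC.
  - by move=> i; apply: gradedP.
  - by rewrite big_split -scaler_sumr /= -!pE.
pose sL : {linear V -> V} := HB.pack s (GRing.isLinear.Build _ _ _ _ s s_lin).
exists sL => n x gx; rewrite /= (sE x n.+1 (fun i => if i == n then x else 0)).
- rewrite big_ord_recr big1 /= => [|i _]; first by rewrite eqxx add0r.
  by rewrite ltn_eqF // scaler0.
- by move=> i; case: eqP => [->|_] //; apply: graded0.
- rewrite big_ord_recr big1 /= => [|i _]; first by rewrite eqxx add0r.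
  by rewrite ltn_eqF.
Qed.

(** This is the grading of the coefficients of a symbol of degree 1. A map of degree -1 on [g]
    becomes degree-preserving from [g] to [shift g], the value 0 in degree 0 included. *)
Definition shift g : nat -> {pred V} :=
  fun n => if n is m.+1 then g m else pred1 0.

Lemma shift_graded : graded (shift g).
Proof.
split=> [[|n]|x|[|n] f gf].
- split=> [|a x y]; rewrite !inE // => /eqP-> /eqP->.
  by rewrite scaler0 addr0.
- exact: graded_submod gr n.
- have [n [f [gf x_f]]] := graded_span gr x.
  exists n.+1, (fun i => if i is j.+1 then f j else 0); split.
    by case=> [|i] //=; rewrite inE.
  by rewrite big_ord_recl add0r.
- by rewrite big_ord0.
- have f0 : f 0%N = 0 by apply/eqP/(gf 0%N).
  rewrite big_ord_recl f0 add0r => sum0 [|i] lt_in //.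
  exact: (@graded_indep _ gr n (fun j => f j.+1) (fun j => gf j.+1) sum0 i lt_in).
Qed.

End Graded.

(** * Direct sums of graded spaces *)

Section GradedProd.
Variables (k : fieldType) (V W : lmodType k).
Variables (g : nat -> {pred V}) (h : nat -> {pred W}).
Hypotheses (gr_g : graded g) (gr_h : graded h).

Definition prod_grade (n : nat) : {pred V * W} :=
  [pred p | (p.1 \in g n) && (p.2 \in h n)].

Lemma prod_graded : graded prod_grade.
Proof.
split=> [n|[x y]|n f gf sum0].
- split=> [|a p q]; rewrite !inE /= ?(graded0 gr_g) ?(graded0 gr_h) //.
  by move=> /andP[? ?] /andP[? ?]; rewrite (gradedP gr_g) ?(gradedP gr_h).
- have [n [f [gf ->]]] := graded_span gr_g x.
  have [m [e [he ->]]] := graded_span gr_h y.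
  rewrite (sum_pad f (leq_addr m n)) (sum_pad e (leq_addl n m)).
  exists (n + m)%N, (fun i => (if (i < n)%N then f i else 0,
                               if (i < m)%N then e i else 0)); split.
    by move=> i; rewrite inE /= (pad_graded gr_g) ?(pad_graded gr_h).
  by rewrite [RHS]surjective_pairing !raddf_sum.
- move=> i lt_in; rewrite [f i]surjective_pairing; congr pair.
    apply: (graded_indep gr_g (f := fun i => (f i).1)) lt_in => [j|].
      by have /andP[] := gf j.
    by rewrite -(raddf_sum fst) sum0.
  apply: (graded_indep gr_h (f := fun i => (f i).2)) lt_in => [j|].
    by have /andP[] := gf j.
  by rewrite -(raddf_sum snd) sum0.
Qed.

End GradedProd.

(** * Reduction to homogeneous elements, and maps between shifted gradings *)

Section GradedMaps.
Variables (k : fieldType) (V W : lmodType k).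
Variables (g : nat -> {pred V}) (h : nat -> {pred W}).
Hypotheses (gr_g : graded g) (gr_h : graded h).

(** This turns axioms with signs, stated for homogeneous elements, into identities in [s] for all
    elements. No case for 0 is required, since 0 is homogeneous. *)
Lemma graded_ind (P : V -> Prop) :
  (forall x y, P x -> P y -> P (x + y)) ->
  (forall n x, x \in g n -> P x) -> forall x, P x.
Proof.
move=> PD Pg x; have [n [f [gf ->]]] := graded_span gr_g x.
apply: big_ind => [||i _]; [exact: Pg (graded0 gr_g 0) | exact: PD |].
exact: Pg (gf i).
Qed.

Lemma shift_homo (f : V -> W) c : f 0 = 0 ->
  (forall n x, x \in g n -> f x \in h (n + c)) ->
  forall n x, x \in shift g n -> f x \in shift h (n + c).
Proof.
move=> f0 fgh [|n] x; last exact: fgh.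
by move=> /eqP->; rewrite f0; apply: (graded0 (shift_graded gr_h)).
Qed.

End GradedMaps.

(* The data and axioms that make Omega (+) M a DGA with M * M = 0, product
   (x, u) (y, v) = (x y, x v + u y + coc x y) and d (x, u) = (d x, eps x + d u). *)
Record sqz_data (k : fieldType) (A : algType k) (Omega : dga A)
    (M : lmodType k) := SqzData {
  sq_grade : nat -> {pred M};
  sq_graded : graded sq_grade;
  sq_grade0 : forall u, u \in sq_grade 0%N -> u = 0;
  sq_l : {bilinear Omega -> M -> M};
  sq_r : {bilinear M -> Omega -> M};
  sq_coc : {bilinear Omega -> Omega -> M};
  sq_d : {linear M -> M};
  sq_eps : {linear Omega -> M};
  sq_l_deg : forall m n x u, x \in grade Omega m -> u \in sq_grade n ->
    sq_l x u \in sq_grade (m + n)%N;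
  sq_r_deg : forall m n u x, u \in sq_grade m -> x \in grade Omega n ->
    sq_r u x \in sq_grade (m + n)%N;
  sq_coc_deg : forall m n x y, x \in grade Omega m -> y \in grade Omega n ->
    sq_coc x y \in sq_grade (m + n)%N;
  sq_d_deg : forall n u, u \in sq_grade n -> sq_d u \in sq_grade n.+1;
  sq_eps_deg : forall n x, x \in grade Omega n -> sq_eps x \in sq_grade n.+1;
  sq_l1 : forall u, sq_l 1 u = u;
  sq_r1 : forall u, sq_r u 1 = u;
  sq_lM : forall x y u, sq_l (x * y) u = sq_l x (sq_l y u);
  sq_rM : forall x y u, sq_r u (x * y) = sq_r (sq_r u x) y;
  sq_lr : forall x y u, sq_r (sq_l x u) y = sq_l x (sq_r u y);
  sq_coc1l : forall x, sq_coc 1 x = 0;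
  sq_coc1r : forall x, sq_coc x 1 = 0;
  sq_cocP : forall x y z,
    sq_coc (x * y) z + sq_r (sq_coc x y) z
    = sq_coc x (y * z) + sq_l x (sq_coc y z);
  sq_dd : forall u, sq_d (sq_d u) = 0;
  sq_d_eps : forall x, sq_eps (dga_d x) + sq_d (sq_eps x) = 0;
  sq_d_l : forall m x u, x \in grade Omega m ->
    sq_d (sq_l x u) = sq_l (dga_d x) u + (-1) ^+ m *: sq_l x (sq_d u);
  sq_d_r : forall m u x, u \in sq_grade m ->
    sq_d (sq_r u x) = sq_r (sq_d u) x + (-1) ^+ m *: sq_r u (dga_d x);
  sq_d_coc : forall m x y, x \in grade Omega m ->
    sq_eps (x * y) + sq_d (sq_coc x y)
    = sq_coc (dga_d x) y + sq_r (sq_eps x) y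
      + (-1) ^+ m *: (sq_coc x (dga_d y) + sq_l x (sq_eps y))
}.

Section DgaGrading.
Variables (k : fieldType) (A : algType k) (E : dga A).

Lemma dga_graded : graded (grade E).
Proof. by split; [apply: grade_submod|apply: grade_span|apply: grade_indep]. Qed.

Lemma dga_in_grade0 a : dga_in a \in grade E 0.
Proof. by apply/grade0P; exists a. Qed.

End DgaGrading.

(** * The DGA structure on a square-zero extension *)

Section SquareZeroExtension.
Variables (k : fieldType) (A : algType k) (Omega : dga A) (M : lmodType k).
Variable D : sqz_data Omega M.

(** The data is a phantom argument: it selects the ring structure twisted by [D], as opposed to the
    componentwise structure of pairs. *)
Definition sqz (_ : sqz_data Omega M) := (Omega * M)%type.

HB.instance Definition _ := GRing.Lmodule.on (sqz D).

Definition sqz_mul (p q : sqz D) : sqz D :=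
  (p.1 * q.1, sq_l D p.1 q.2 + sq_r D p.2 q.1 + sq_coc D p.1 q.1).

Let sqz_mulA : associative sqz_mul.
Proof.
move=> [x u] [y v] [z w]; congr pair; rewrite /= ?mulrA //.
rewrite !linearDl !linearDr /= !sq_lM !sq_rM !sq_lr.
(* The cocycle condition is solved for [sq_coc D x (y * z)] and substituted. *)
have /eqP := sq_cocP D x y z; rewrite -subr_eq => /eqP <-; zmod.
Qed.

Let sqz_mul1l : left_id ((1, 0) : sqz D) sqz_mul.
Proof.
by move=> [x u]; rewrite /sqz_mul /= mul1r sq_l1 sq_coc1l linear0l !addr0.
Qed.

Let sqz_mul1r : right_id ((1, 0) : sqz D) sqz_mul.
Proof.
by move=> [x u]; rewrite /sqz_mul /= mulr1 sq_r1 sq_coc1r linear0r addr0 add0r.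
Qed.

Let sqz_mulDl : left_distributive sqz_mul +%R.
Proof.
move=> [x u] [y v] [z w]; congr pair; rewrite /= ?mulrDl // !linearDl /=.
by zmod.
Qed.

Let sqz_mulDr : right_distributive sqz_mul +%R.
Proof.
move=> [x u] [y v] [z w]; congr pair; rewrite /= ?mulrDr // !linearDr /=.
by zmod.
Qed.

Let sqz_one_neq0 : (1, 0) != 0 :> sqz D.
Proof. by rewrite xpair_eqE oner_eq0. Qed.

HB.instance Definition _ := GRing.Zmodule_isNzRing.Build (sqz D)
  sqz_mulA sqz_mul1l sqz_mul1r sqz_mulDl sqz_mulDr sqz_one_neq0.

Let sqz_scaleAl (c : k) (p q : sqz D) : c *: (p * q) = (c *: p) * q.
Proof.
case: p q => [x u] [y v]; congr pair; rewrite /= ?scalerAl //.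
by rewrite !linearZl_LR !scalerDr.
Qed.

HB.instance Definition _ := GRing.Lmodule_isLalgebra.Build k (sqz D) sqz_scaleAl.

Let sqz_scaleAr (c : k) (p q : sqz D) : c *: (p * q) = p * (c *: q).
Proof.
case: p q => [x u] [y v]; congr pair; rewrite /= ?scalerAr //.
by rewrite !linearZr_LR !scalerDr.
Qed.

HB.instance Definition _ := GRing.Lalgebra_isAlgebra.Build k (sqz D) sqz_scaleAr.

Definition sqz_in (a : A) : sqz D := (dga_in a, 0).

Let sqz_in_linear : linear sqz_in.
Proof.
by move=> c a b; rewrite /sqz_in linearP; congr pair; rewrite /= scaler0 addr0.
Qed.

Let sqz_in_multiplicative : monoid_morphism sqz_in.
Proof.
split=> [|a b]; rewrite /sqz_in ?rmorph1 // rmorphM; congr pair => /=.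
rewrite linear0l linear0r !add0r.
(* The cocycle of two elements of degree 0 lies in degree 0 of [M], which is zero; hence [A] still
   embeds multiplicatively. *)
apply/esym/(@sq_grade0 _ _ _ _ D)/(@sq_coc_deg _ _ _ _ D 0 0);
  exact: dga_in_grade0.
Qed.

HB.instance Definition _ := GRing.isLinear.Build k A (sqz D) _ sqz_in sqz_in_linear.
HB.instance Definition _ :=
  GRing.isMonoidMorphism.Build A (sqz D) sqz_in sqz_in_multiplicative.

Definition sqz_d (p : sqz D) : sqz D :=
  (dga_d p.1, sq_eps D p.1 + sq_d D p.2).

Let sqz_d_linear : linear sqz_d.
Proof.
move=> c [x u] [y v]; congr pair; rewrite /= !linearP //.
by rewrite scalerDr; zmod.
Qed.

HB.instance Definition _ :=
  GRing.isLinear.Build k (sqz D) (sqz D) _ sqz_d sqz_d_linear.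

Definition sqz_grade : nat -> {pred sqz D} :=
  prod_grade (grade Omega) (sq_grade D).

Let sqz_graded : graded sqz_grade.
Proof. exact: prod_graded (dga_graded Omega) (sq_graded D). Qed.

Let sqz_grade_mul m n p q :
  p \in sqz_grade m -> q \in sqz_grade n -> p * q \in sqz_grade (m + n)%N.
Proof.
move=> /andP[p1 p2] /andP[q1 q2]; rewrite inE /= grade_mul //=.
by rewrite !(gradedD (sq_graded D)) ?sq_l_deg ?sq_r_deg ?sq_coc_deg.
Qed.

Let sqz_in_inj : injective sqz_in.
Proof. by move=> a b [/dga_in_inj]. Qed.

Let sqz_grade0P p : p \in sqz_grade 0 <-> exists a, p = sqz_in a.
Proof.
split=> [/andP[]|[a ->]].
  case: p => x u /= /grade0P[a ->] /sq_grade0 ->; by exists a.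
by rewrite inE /= dga_in_grade0 (graded0 (sq_graded D)).
Qed.

Let sqz_d_deg n p : p \in sqz_grade n -> sqz_d p \in sqz_grade n.+1.
Proof.
move=> /andP[p1 p2]; rewrite inE /= dga_d_deg //=.
by rewrite (gradedD (sq_graded D)) ?sq_d_deg ?sq_eps_deg.
Qed.

Let sqz_dd p : sqz_d (sqz_d p) = 0.
Proof.
case: p => x u; congr pair; rewrite /= ?dga_dd // linearD /= sq_dd addr0.
exact: sq_d_eps.
Qed.

Let sqz_leibniz m p q : p \in sqz_grade m ->
  sqz_d (p * q) = sqz_d p * q + (-1) ^+ m *: (p * sqz_d q).
Proof.
case: p q => [x u] [y v] /andP[/= gx gu]; congr pair => /=.
  exact: dga_leibniz.
rewrite !linearD /= (sq_d_l D v gx) (sq_d_r y gu).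
rewrite linearDl /=.
(* The differential of the cocycle is added and subtracted to form the left side of [sq_d_coc]. *)
rewrite -[sq_eps D (x * y)](addrK (sq_d D (sq_coc D x y))).
by rewrite (sq_d_coc D y gx) scalerDr; zmod.
Qed.

Definition sqz_dga : dga A :=
  @DGA k A (sqz D) sqz_grade (graded_submod sqz_graded) (graded_span sqz_graded)
    (graded_indep sqz_graded) sqz_grade_mul sqz_in sqz_in_inj sqz_grade0P
    sqz_d sqz_d_deg sqz_dd sqz_leibniz.

End SquareZeroExtension.

(** * The projection of a square-zero extension onto its base and the linear section *)

Section SquareZeroProjection.
Variables (k : fieldType) (A : algType k) (Omega : dga A) (M : lmodType k).
Variable D : sqz_data Omega M.

Definition sqz_fst (p : sqz_dga D) : Omega := p.1.

Let sqz_fst_linear : linear sqz_fst. Proof. by []. Qed.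
Let sqz_fst_multiplicative : monoid_morphism sqz_fst. Proof. by []. Qed.

HB.instance Definition _ :=
  GRing.isLinear.Build k (sqz_dga D) Omega _ sqz_fst sqz_fst_linear.
HB.instance Definition _ := GRing.isMonoidMorphism.Build
  (sqz_dga D) Omega sqz_fst sqz_fst_multiplicative.

Lemma sqz_fst_surjection : dga_surjection sqz_fst.
Proof.
by split; [split=> // n x /andP[] | move=> y; exists (y, 0)].
Qed.

Definition sqz_incl (x : Omega) : sqz_dga D := (x, 0).

Let sqz_incl_linear : linear sqz_incl.
Proof. by move=> c x y; congr pair; rewrite /= scaler0 addr0. Qed.

HB.instance Definition _ :=
  GRing.isLinear.Build k Omega (sqz_dga D) _ sqz_incl sqz_incl_linear.

Lemma sqz_incl_deg n x : x \in grade Omega n ->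
  sqz_incl x \in grade (sqz_dga D) n.
Proof. by move=> gx; apply/andP; split=> //; apply: (graded0 (sq_graded D)). Qed.

End SquareZeroProjection.

(** * Composition and inversion of DGA morphisms *)

Section DgaMorphisms.
Variables (k : fieldType) (A : algType k).

Lemma dga_surjection_comp (E F G : dga A) (f : {lrmorphism F -> G})
    (h : {lrmorphism E -> F}) (fh : {lrmorphism E -> G}) :
  fh =1 f \o h -> dga_surjection f -> dga_surjection h -> dga_surjection fh.
Proof.
move=> fhE [[fdeg fin fd] fsurj] [[hdeg hin hd] hsurj]; split; first split.
- by move=> n x /hdeg /fdeg; rewrite fhE.
- by move=> a; rewrite fhE /= hin fin.
- by move=> x; rewrite !fhE /= hd fd.
- move=> z; have [y <-] := fsurj z; have [x <-] := hsurj y.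
  by exists x; rewrite fhE.
Qed.

(* The inverse preserves degrees: projecting a preimage to degree [n] does not
   change its image. *)
Lemma dga_iso_inv (E F : dga A) (f : {lrmorphism E -> F})
    (h : {lrmorphism F -> E}) : cancel f h -> cancel h f ->
  dga_morphism f -> dga_surjection f /\ dga_surjection h.
Proof.
move=> fK hK fmor; have [fdeg fin fd] := fmor.
split; [by split=> // y; exists (h y)|split; last by move=> x; exists (f x)].
split=> [n y gy|a|y].
- have [N [e [ge hy]]] := graded_span (dga_graded E) (h y).
  have yE : y = \sum_(i < N) f (e i) by rewrite -{1}[y]hK hy linear_sum.
  rewrite (graded_proj (dga_graded F) (fun i => fdeg _ _ (ge i)) gy yE).
  rewrite linear_sum; apply: (graded_sum (dga_graded E)) => i.
  rewrite linearZ /= fK; case: eqP => [<-|_].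
    exact: (gradedZ (dga_graded E)).
  by rewrite scale0r; apply: (graded0 (dga_graded E)).
- by rewrite -fin fK.
- by apply: (can_inj fK); rewrite fd !hK.
Qed.

End DgaMorphisms.

(** * The cocycles defined by [perp] and [delta] *)

Section Cocycles.
Variables (k : fieldType) (A : algType k) (Omega : dga A).
Variable s : {linear Omega -> Omega}.
Hypothesis sE : forall n x, x \in grade Omega n -> s x = (-1) ^+ n *: x.
Variable perp : {bilinear Omega -> Omega -> Omega}.
Hypothesis perp_deg : has_degree2 (-2) (fun w y : Omega => perp w y).
Hypothesis perp0 : forall (a : A) (w : Omega),
  perp w (dga_in a) = 0 /\ perp (dga_in a) w = 0.
Hypothesis perpP : forall (m n p : nat) (w y z : Omega),
  w \in grade Omega m -> y \in grade Omega n -> z \in grade Omega p ->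
  (-1) ^+ n *: perp (w * y) z + perp w y * z
  = perp w (y * z) + (-1) ^+ (m + n) *: (w * perp y z).
Variable delta : {linear Omega -> Omega}.
Hypothesis delta_deg : has_degree (-1) delta.
Variable c : k.

Local Notation d := (@dga_d k A Omega).
Local Notation g := (grade Omega).
Local Notation gr := (dga_graded Omega).
Local Notation gr1 := (shift_graded gr).
Local Notation gr2 := (shift_graded gr1).
Implicit Types x y z u v : Omega.

(** * Degrees of the operations in the shifted gradings *)

Lemma delta_shift n x : x \in g n -> delta x \in shift g n.
Proof.
move=> /delta_deg; case: n => [|n] //.
by rewrite -addn1 PoszD addrK addn1.
Qed.

Lemma perp_shift m n x y : x \in g m -> y \in g n ->
  perp x y \in shift (shift g) (m + n)%N.
Proof.
move=> gx gy; move: (perp_deg gx gy); case: (m + n)%N => [|[|N]] //.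
by rewrite -addn2 PoszD addrK addn2.
Qed.

Lemma mull_shift m n x u : x \in g m -> u \in shift g n ->
  x * u \in shift g (m + n)%N.
Proof.
move=> gx; rewrite addnC; apply: (shift_homo gr) => [|j y gy].
  exact: mulr0.
by rewrite addnC grade_mul.
Qed.

Lemma mulr_shift m n u x : u \in shift g m -> x \in g n ->
  u * x \in shift g (m + n)%N.
Proof.
move=> gu gx; apply: (shift_homo (f := fun u => u * x) gr) gu => [|j y gy].
  exact: mul0r.
exact: grade_mul.
Qed.

Lemma mull_shift2 m n x u : x \in g m -> u \in shift (shift g) n ->
  x * u \in shift (shift g) (m + n)%N.
Proof.
move=> gx; rewrite addnC; apply: (shift_homo gr1) => [|j y gy].
  exact: mulr0.
by rewrite addnC mull_shift.
Qed.

Lemma mulr_shift2 m n u x : u \in shift (shift g) m -> x \in g n ->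
  u * x \in shift (shift g) (m + n)%N.
Proof.
move=> gu gx; apply: (shift_homo (f := fun u => u * x) gr1) gu => [|j y gy].
  exact: mul0r.
exact: mulr_shift.
Qed.

Lemma d_shift n u : u \in shift g n -> d u \in shift g n.+1.
Proof.
rewrite -addn1; apply: (shift_homo gr) => [|j y gy]; first exact: linear0.
by rewrite addn1 dga_d_deg.
Qed.

Lemma d_shift2 n u : u \in shift (shift g) n -> d u \in shift (shift g) n.+1.
Proof.
rewrite -addn1; apply: (shift_homo gr1) => [|j y gy]; first exact: linear0.
by rewrite addn1 d_shift.
Qed.

Lemma s_deg n x : x \in g n -> s x \in g n.
Proof. by move=> gx; rewrite (sE gx) (gradedZ gr). Qed.

Lemma s_shift n u : u \in shift g n -> s u \in shift g n.
Proof.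
rewrite -{2}[n]addn0; apply: (shift_homo gr) => [|j y gy].
  exact: linear0.
by rewrite addn0 s_deg.
Qed.

(** Shifted degree [n] means degree [n - 1] in [Omega], whence the extra sign; a second shift
    cancels it. *)
Lemma sE_shift n u : u \in shift g n -> s u = - ((-1) ^+ n *: u).
Proof.
case: n => [/eqP->|n gu]; first by rewrite linear0 scaler0 oppr0.
by rewrite (sE gu) exprS mulN1r scaleNr opprK.
Qed.

Lemma sE_shift2 n u : u \in shift (shift g) n -> s u = (-1) ^+ n *: u.
Proof.
case: n => [/eqP->|n gu]; first by rewrite linear0 scaler0.
by rewrite (sE_shift gu) exprS mulN1r scaleNr.
Qed.

(** * Sign-free rules for the parity involution *)

Lemma sK x : s (s x) = x.
Proof.
elim/(graded_ind gr): x => [x y sx sy|n x gx]; first by rewrite !linearD sx sy.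
by rewrite (sE (s_deg gx)) (sE gx) scalerA -exprMn mulrNN mulr1 expr1n scale1r.
Qed.

Lemma s1 : s 1 = 1.
Proof. by rewrite -(rmorph1 (@dga_in _ _ Omega)) (sE (dga_in_grade0 _ _)) scale1r. Qed.

Lemma sM x y : s (x * y) = s x * s y.
Proof.
elim/(graded_ind gr): x => [x x' sx sx'|m x gx].
  by rewrite mulrDl !linearD /= sx sx' mulrDl.
elim/(graded_ind gr): y => [y y' sy sy'|n y gy].
  by rewrite mulrDr !linearD /= sy sy' mulrDr.
rewrite (sE (grade_mul gx gy)) (sE gx) (sE gy).
by rewrite -scalerAl -scalerAr scalerA exprD.
Qed.

Lemma s_d x : s (d x) = - d (s x).
Proof.
elim/(graded_ind gr): x => [x y sx sy|n x gx].
  by rewrite !linearD /= sx sy.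
by rewrite (sE (dga_d_deg gx)) (sE gx) (linearZ_LR d) exprS mulN1r scaleNr.
Qed.

Lemma dM x y : d (x * y) = d x * y + s x * d y.
Proof.
elim/(graded_ind gr): x => [x x' dx dx'|m x gx].
  by rewrite mulrDl !linearD /= dx dx' !mulrDl; zmod.
by rewrite (dga_leibniz _ gx) (sE gx) -scalerAl.
Qed.

Lemma s_delta x : s (delta x) = - delta (s x).
Proof.
elim/(graded_ind gr): x => [x y sx sy|n x gx].
  by rewrite !linearD /= sx sy.
by rewrite (sE_shift (delta_shift gx)) (sE gx) (linearZ_LR delta).
Qed.

Lemma s_perp x y : s (perp x y) = perp (s x) (s y).
Proof.
elim/(graded_ind gr): x => [x x' sx sx'|m x gx].
  by rewrite linearDl !linearD /= sx sx' linearDl.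
elim/(graded_ind gr): y => [y y' sy sy'|n y gy].
  by rewrite linearDr !linearD /= sy sy'.
rewrite (sE_shift2 (perp_shift gx gy)) (sE gx) (sE gy).
by rewrite linearZl_LR linearZr_LR scalerA exprD.
Qed.

(** * The four-term relation without signs, and values at the unit *)

Lemma perpE x y z :
  perp (x * s y) z = perp x (y * z) + s x * perp (s y) z - perp x y * z.
Proof.
apply/eqP; rewrite -subr_eq opprK; apply/eqP.
elim/(graded_ind gr): x => [x x' h h'|m x gx].
  rewrite mulrDl !linearDl linearD /= !mulrDl addrACA h h'; zmod.
elim/(graded_ind gr): y => [y y' h h'|n y gy].
  rewrite linearD /= !mulrDr mulrDl !linearDl !linearDr /= mulrDl mulrDr.
  by rewrite addrACA h h'; zmod.
elim/(graded_ind gr): z => [z z' h h'|p z gz].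
  by rewrite !mulrDr !linearDr /= mulrDr addrACA h h'; zmod.
rewrite (sE gx) (sE gy) -scalerAr !linearZl_LR /= -scalerAr -scalerAl scalerA.
by rewrite -exprD addnC (perpP gx gy gz).
Qed.

(** Oriented as a rewrite rule that removes products from the left argument of [perp]. *)
Lemma perpM x y z :
  perp (x * y) z = perp x (s y * z) + s x * perp y z - perp x (s y) * z.
Proof. by rewrite -{1}[y]sK perpE sK. Qed.

Lemma perp1l x : perp 1 x = 0.
Proof. by rewrite -(rmorph1 (@dga_in _ _ Omega)); case: (perp0 1 x). Qed.

Lemma perp1r x : perp x 1 = 0.
Proof. by rewrite -(rmorph1 (@dga_in _ _ Omega)); case: (perp0 1 x). Qed.

Lemma delta1 : delta 1 = 0.
Proof.
apply/eqP; rewrite -(rmorph1 (@dga_in _ _ Omega)).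
exact: delta_shift (dga_in_grade0 _ _).
Qed.

Lemma d1 : d 1 = 0.
Proof.
have := dM 1 1; rewrite s1 !mulr1 mul1r => /eqP.
by rewrite -subr_eq0 opprD addNKr oppr_eq0 => /eqP.
Qed.

(** * The bracket as a cocycle and its relation to the Laplacian *)

(* Includes the factor (-1)^(m+n) of the product formula. *)
Definition sbr x y : Omega :=
  delta (s x * s y) - delta (s x) * s y - x * delta (s y)
  + perp (s x) (d (s y)) - perp (d x) (s y) - d (perp x (s y)).

Lemma sbrE m n x y : x \in g m -> y \in g n ->
  sbr x y = (-1) ^+ (m + n) *: bracket (fun w : Omega => delta w)
    (fun w y : Omega => perp w y) m x y.
Proof.
move=> gx gy; rewrite /bracket /Lop.
have sgn2 : (-1) ^+ (m + n) * (-1) ^+ m = (-1) ^+ n :> k.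
  by rewrite exprD mulrAC -exprMn mulrNN mulr1 expr1n mul1r.
rewrite !(scalerDr, scalerN) !scalerA sgn2 exprD.
rewrite /sbr (sE gx) (sE gy) -!(scalerAl, scalerAr).
rewrite !(linearZ_LR d, linearZ_LR delta, linearZl_LR, linearZr_LR) /=.
by rewrite -!(scalerAl, scalerAr) !scalerA [(-1) ^+ n * _]mulrC.
Qed.

Lemma sbr_bilinear : bilinear_for *:%R *:%R sbr.
Proof.
split=> z a x y; rewrite /sbr.
  rewrite !(linearP s, linearP d, mulrDl, linearPl) /= -!scalerAl.
  rewrite !(linearP delta, linearP d, mulrDl) /= -!scalerAl.
  rewrite !(scalerDr, scalerN); zmod.
rewrite !(linearP s, linearP d, mulrDr, linearPr) /= -!scalerAr.
rewrite !(linearP delta, linearP d, mulrDr, linearPr) /= -!scalerAr.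
by rewrite !(scalerDr, scalerN); zmod.
Qed.

(** A rewriting system bringing both sides of an identity to sums of the same monomials, which
    [zmod] then compares. Products under [delta] stay as they are, since [delta] is not a
    derivation. *)
Definition normE := (sM, dM, perpM, s_d, s_delta, s_perp, sK, @dga_dd _ _ Omega,
  @mulrDl Omega, @mulrDr Omega, @mulrN Omega, @mulNr Omega,
  @mulr0 Omega, @mul0r Omega, @mulrA Omega,
  (linearD d, linearD s, linearD delta, linearN d, linearN s, linearN delta),
  (linear0 d, linear0 s, linear0 delta),
  (linearDl perp, linearDr perp, linearNl perp, linearNr perp),
  (linear0l perp, linear0r perp)).

(** The [delta] terms are the coboundary of [delta \o s] for the right action twisted by [s], and
    cancel by associativity. The [perp] terms cancel by the Leibniz rule and [perpM]. *)
Lemma sbr_cocycle x y z :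
  sbr (x * y) z + sbr x y * s z = sbr x (y * z) + x * sbr y z.
Proof. rewrite /sbr !normE /=. zmod. Qed.

(** The [theta'] component of [sq_d_coc] without the factor [c]. The terms [d (delta _)] of the
    Laplacians cancel those of [d (sbr x y)]. *)
Lemma laplacian_sbr x y :
  - laplacian delta (s (x * y)) + d (sbr x y)
  = sbr (d x) y - laplacian delta (s x) * s y
    + (sbr (s x) (d y) - s x * laplacian delta (s y)).
Proof. rewrite /sbr /laplacian !normE /=. zmod. Qed.

(** The [dtheta'] component of [sq_d_coc] without the factor [c]: applying [s] to [sbr] undoes its
    twists, up to sign, and what remains is the definition of the bracket rearranged. *)
Lemma s_sbr x y :
  delta (x * y) + (s (sbr x y) - d (perp (s x) y))
  = - perp (s (d x)) y + delta x * y
    + (- perp x (d y) + s x * delta y).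
Proof. rewrite /sbr !normE /=. zmod. Qed.

Lemma sbr_shift m n x y : x \in g m -> y \in g n ->
  sbr x y \in shift g (m + n)%N.
Proof.
move=> gx gy; have [gsx gsy] := (s_deg gx, s_deg gy); rewrite /sbr.
(* By computation [shift (shift g) n.+1] is [shift g n], so [d] of a doubly shifted element has the
   required degree. *)
apply: (gradedB gr1); last exact: (d_shift2 (perp_shift gx gsy)).
apply: (gradedB gr1).
  apply: (gradedD gr1).
    apply: (gradedB gr1); last exact: mull_shift gx (delta_shift gsy).
    apply: (gradedB gr1); last exact: mulr_shift (delta_shift gsx) gsy.
    exact: delta_shift (grade_mul gsx gsy).
  by have := perp_shift gsx (dga_d_deg gsy); rewrite addnS.
by have := perp_shift (dga_d_deg gx) gsy; rewrite addSn.
Qed.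

Lemma sbr1l y : sbr 1 y = 0.
Proof.
rewrite /sbr s1 d1 delta1 !mul1r mul0r !perp1l linear0l (linear0 d).
by zmod.
Qed.

Lemma sbr1r x : sbr x 1 = 0.
Proof.
rewrite /sbr s1 d1 delta1 !mulr1 mulr0 !perp1r linear0r (linear0 d).
by zmod.
Qed.

Lemma laplacian_shift n x : x \in g n -> laplacian delta x \in g n.
Proof.
move=> gx; apply: (gradedD gr); first exact: (d_shift (delta_shift gx)).
exact: (delta_shift (dga_d_deg gx)).
Qed.

(** * The bimodule, cocycle and differential in the [theta'] component *)

(* Here u : Omega stands for u theta', and (u, v) : Omega * Omega below for
   u theta' + v dtheta'; c stands for lambda / 2. *)
Definition lmul1 x u := x * u.
(** The twist is the sign acquired when [theta'] moves past [x]. *)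
Definition rmul1 u x := u * s x.
Definition coc1 x y := c *: sbr x y.
Definition eps1 x := - (c *: laplacian delta (s x)).

Let lmul1_bilinear : bilinear_for *:%R *:%R lmul1.
Proof.
by split=> z a x y; rewrite /lmul1 ?mulrDl ?mulrDr -?scalerAl -?scalerAr.
Qed.

Let rmul1_bilinear : bilinear_for *:%R *:%R rmul1.
Proof.
by split=> z a x y; rewrite /rmul1 ?linearP /= ?mulrDl ?mulrDr -?scalerAl -?scalerAr.
Qed.

Let coc1_bilinear : bilinear_for *:%R *:%R coc1.
Proof.
split=> z a x y; rewrite /coc1; first rewrite sbr_bilinear.1.
  by rewrite /= scalerDr !scalerA [c * a]mulrC.
by rewrite sbr_bilinear.2 /= scalerDr !scalerA [c * a]mulrC.
Qed.

Let eps1_linear : linear eps1.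
Proof.
move=> a x y; rewrite /eps1 /laplacian (linearP s) !(linearP delta, linearP d) /=.
rewrite !(scalerDr, scalerN, opprD) !scalerA [a * c]mulrC.
by zmod.
Qed.

HB.instance Definition _ :=
  bilinear_isBilinear.Build k Omega Omega Omega _ _ lmul1 lmul1_bilinear.
HB.instance Definition _ :=
  bilinear_isBilinear.Build k Omega Omega Omega _ _ rmul1 rmul1_bilinear.
HB.instance Definition _ :=
  bilinear_isBilinear.Build k Omega Omega Omega _ _ coc1 coc1_bilinear.
HB.instance Definition _ := GRing.isLinear.Build k Omega Omega _ eps1 eps1_linear.

Lemma coc1_cocycle x y z :
  coc1 (x * y) z + rmul1 (coc1 x y) z = coc1 x (y * z) + lmul1 x (coc1 y z).
Proof.
by rewrite /coc1 /rmul1 /lmul1 -scalerAl -scalerAr -!scalerDr sbr_cocycle.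
Qed.

Lemma d_eps1 x : eps1 (d x) + d (eps1 x) = 0.
Proof.
rewrite /eps1 /laplacian !normE /= (linearZ_LR d) !normE /=.
by rewrite !(scalerDr, scalerN); zmod.
Qed.

(** Here [m] is the degree of [u theta'], one more than that of [u]; the resulting sign cancels the
    one from moving [s] past [d]. *)
Lemma d_rmul1 m u x : u \in shift g m ->
  d (rmul1 u x) = rmul1 (d u) x + (-1) ^+ m *: rmul1 u (d x).
Proof.
move=> gu; rewrite /rmul1 dM (sE_shift gu) s_d.
by rewrite mulrN scalerN mulNr -scalerAl.
Qed.

Lemma d_coc1 m x y : x \in g m ->
  eps1 (x * y) + d (coc1 x y)
  = coc1 (d x) y + rmul1 (eps1 x) y
    + (-1) ^+ m *: (coc1 x (d y) + lmul1 x (eps1 y)).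
Proof.
move=> gx.
have coc_s : (-1) ^+ m *: coc1 x (d y) = coc1 (s x) (d y).
  by rewrite (sE gx) linearZl_LR.
have eps_s u : (-1) ^+ m *: (c *: (x * u)) = c *: (s x * u).
  by rewrite (sE gx) -scalerAl !scalerA mulrC.
rewrite /rmul1 /lmul1 /eps1 mulNr mulrN -scalerAl -scalerAr scalerBr coc_s eps_s.
by rewrite /coc1 (linearZ_LR d) -!scalerN -!scalerDr laplacian_sbr.
Qed.

(** * The same data with both [theta'] and [dtheta'] components *)

Definition lmul2 x (p : Omega * Omega) := (x * p.1, x * p.2).
(** Only the first component is twisted, because [dtheta'] has even degree. *)
Definition rmul2 (p : Omega * Omega) x := (p.1 * s x, p.2 * x).
Definition coc2 x y := (coc1 x y, - (c *: perp (s x) y)).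
Definition eps2 x := (eps1 x, c *: delta x).
(** The term [s p.1] is the Leibniz contribution of [u theta'] to the coefficient of [dtheta']. *)
Definition d2 (p : Omega * Omega) := (d p.1, s p.1 + d p.2).

Let lmul2_bilinear : bilinear_for *:%R *:%R lmul2.
Proof.
by split=> z a x y; congr pair; rewrite /= ?mulrDl ?mulrDr -?scalerAl -?scalerAr.
Qed.

Let rmul2_bilinear : bilinear_for *:%R *:%R rmul2.
Proof.
by split=> z a x y; congr pair;
  rewrite /= ?(linearP s) /= ?mulrDl ?mulrDr -?scalerAl -?scalerAr.
Qed.

Let coc2_bilinear : bilinear_for *:%R *:%R coc2.
Proof.
split=> z a x y; congr pair.
- exact: coc1_bilinear.1.
- rewrite /= (linearP s) linearPl /= !(scalerDr, scalerN) !scalerA [c * a]mulrC.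
  by zmod.
- exact: coc1_bilinear.2.
- rewrite /= linearPr /= !(scalerDr, scalerN) !scalerA [c * a]mulrC.
  by zmod.
Qed.

Let eps2_linear : linear eps2.
Proof.
move=> a x y; congr pair; first exact: linearP.
by rewrite /= (linearP delta) scalerDr !scalerA [c * a]mulrC.
Qed.

Let d2_linear : linear d2.
Proof.
move=> a x y; congr pair; first exact: linearP.
by rewrite /= (linearP s) (linearP d) scalerDr; zmod.
Qed.

HB.instance Definition _ := bilinear_isBilinear.Build
  k Omega (Omega * Omega)%type (Omega * Omega)%type _ _ lmul2 lmul2_bilinear.
HB.instance Definition _ := bilinear_isBilinear.Build
  k (Omega * Omega)%type Omega (Omega * Omega)%type _ _ rmul2 rmul2_bilinear.
HB.instance Definition _ := bilinear_isBilinear.Build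
  k Omega Omega (Omega * Omega)%type _ _ coc2 coc2_bilinear.
HB.instance Definition _ :=
  GRing.isLinear.Build k Omega (Omega * Omega)%type _ eps2 eps2_linear.
HB.instance Definition _ := GRing.isLinear.Build
  k (Omega * Omega)%type (Omega * Omega)%type _ d2 d2_linear.

Lemma coc2_cocycle x y z :
  coc2 (x * y) z + rmul2 (coc2 x y) z = coc2 x (y * z) + lmul2 x (coc2 y z).
Proof.
congr pair; first exact: coc1_cocycle.
rewrite /= mulNr mulrN -scalerAl -scalerAr -!opprD -!scalerDr.
by rewrite !normE; congr (- (_ *: _)); zmod.
Qed.

(** In the [dtheta'] component the two [delta] terms add up to the Laplacian, which [s (eps1 x)]
    cancels since the Laplacian preserves parity. *)
Lemma d_eps2 x : eps2 (d x) + d2 (eps2 x) = 0.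
Proof.
congr pair; first exact: d_eps1.
rewrite /= /eps1 (linearZ_LR d) (linearN s) (linearZ_LR s) -scalerN -!scalerDr.
by rewrite /laplacian !normE -[RHS](scaler0 _ c); congr (_ *: _); zmod.
Qed.

Lemma d_lmul2 m x p : x \in g m ->
  d2 (lmul2 x p) = lmul2 (d x) p + (-1) ^+ m *: lmul2 x (d2 p).
Proof.
move=> gx; congr pair; rewrite /= (dga_leibniz _ gx) // sM (sE gx) -scalerAl.
by rewrite mulrDr scalerDr; zmod.
Qed.

Lemma d_rmul2 m p x : p \in prod_grade (shift g) (shift (shift g)) m ->
  d2 (rmul2 p x) = rmul2 (d2 p) x + (-1) ^+ m *: rmul2 p (d x).
Proof.
move=> /andP[p1 p2]; congr pair; first exact: d_rmul1.
by rewrite /= sM dM sK (sE_shift2 p2) mulrDl -scalerAl; zmod.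
Qed.

Lemma d_coc2 m x y : x \in g m ->
  eps2 (x * y) + d2 (coc2 x y)
  = coc2 (d x) y + rmul2 (eps2 x) y
    + (-1) ^+ m *: (coc2 x (d y) + lmul2 x (eps2 y)).
Proof.
move=> gx; congr pair; first exact: d_coc1.
have perp_s : (-1) ^+ m *: (c *: perp (s x) (d y)) = c *: perp x (d y).
  by rewrite -[x in RHS]sK (sE (s_deg gx)) linearZl_LR !scalerA mulrC.
have delta_s : (-1) ^+ m *: (x * (c *: delta y)) = c *: (s x * delta y).
  by rewrite (sE gx) -scalerAl -scalerAr !scalerA mulrC.
rewrite /= scalerDr scalerN perp_s delta_s -scalerAl /coc1.
rewrite (linearN d) (linearZ_LR d) (linearZ_LR s) /=.
by rewrite -!scalerN -!scalerDr s_sbr.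
Qed.

(** * Assembly of the two square-zero extensions, with [theta'] in degree 1 and [dtheta'] in degree
    2 *)

Let grade2 := prod_grade (shift g) (shift (shift g)).

Lemma eps1_shift n x : x \in g n -> eps1 x \in shift g n.+1.
Proof.
by move=> gx; apply/(gradedN gr)/(gradedZ gr)/laplacian_shift/s_deg.
Qed.

Lemma coc1_shift m n x y : x \in g m -> y \in g n ->
  coc1 x y \in shift g (m + n)%N.
Proof. by move=> gx gy; apply/(gradedZ gr1)/sbr_shift. Qed.

Lemma rmul1_shift m n u x : u \in shift g m -> x \in g n ->
  rmul1 u x \in shift g (m + n)%N.
Proof. by move=> gu gx; apply/(mulr_shift gu)/s_deg. Qed.

(** Kept transparent so that the product and differential of the extension reduce by conversion. *)
Definition sqz1 : sqz_data Omega Omega.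
Proof.
apply: (@SqzData _ _ Omega Omega (shift g) gr1 _ lmul1 rmul1 coc1 d eps1).
- by move=> u /eqP.
- exact: mull_shift.
- exact: rmul1_shift.
- exact: coc1_shift.
- exact: d_shift.
- exact: eps1_shift.
- exact: mul1r.
- by move=> u; rewrite /= /rmul1 s1 mulr1.
- by move=> x y u; rewrite /= /lmul1 mulrA.
- by move=> x y u; rewrite /= /rmul1 sM mulrA.
- by move=> x y u; rewrite /= /lmul1 /rmul1 mulrA.
- by move=> x; rewrite /= /coc1 sbr1l scaler0.
- by move=> x; rewrite /= /coc1 sbr1r scaler0.
- exact: coc1_cocycle.
- exact: dga_dd.
- exact: d_eps1.
- by move=> m x u; apply: dga_leibniz.
- exact: d_rmul1.
- exact: d_coc1.
Defined.

Definition sqz2 : sqz_data Omega (Omega * Omega)%type.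
Proof.
apply: (@SqzData _ _ Omega (Omega * Omega)%type grade2 (prod_graded gr1 gr2)
  _ lmul2 rmul2 coc2 d2 eps2).
- by move=> [u v] /andP[/eqP /= -> /eqP /= ->].
- move=> m n x p gx /andP[p1 p2]; apply/andP; split; first exact: mull_shift.
  exact: mull_shift2.
- move=> m n p x /andP[p1 p2] gx; apply/andP; split; first exact: rmul1_shift.
  exact: mulr_shift2.
- move=> m n x y gx gy; apply/andP; split; first exact: coc1_shift.
  exact/(gradedN gr2)/(gradedZ gr2)/perp_shift/gy/s_deg.
- move=> n p /andP[p1 p2]; apply/andP; split; first exact: d_shift.
  by apply: (gradedD gr2); [apply: s_shift | apply: d_shift2].
- move=> n x gx; apply/andP; split; first exact: eps1_shift.
  exact/(gradedZ gr1)/delta_shift.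
- by move=> [u v]; rewrite /= /lmul2 !mul1r.
- by move=> [u v]; rewrite /= /rmul2 s1 !mulr1.
- by move=> x y u; rewrite /= /lmul2 !mulrA.
- by move=> x y u; rewrite /= /rmul2 sM !mulrA.
- by move=> x y u; rewrite /= /lmul2 /rmul2 !mulrA.
- by move=> x; rewrite /= /coc2 /coc1 sbr1l s1 perp1l !scaler0 oppr0.
- by move=> x; rewrite /= /coc2 /coc1 sbr1r perp1r !scaler0 oppr0.
- exact: coc2_cocycle.
- move=> [u v]; congr pair; rewrite /= ?dga_dd // linearD /= dga_dd s_d.
  by zmod.
- exact: d_eps2.
- exact: d_lmul2.
- exact: d_rmul2.
- exact: d_coc2.
Defined.

(** * Explicit formulas in the models and verification of the extension axioms *)

Lemma one_grade0 : 1 \in g 0.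
Proof. by rewrite -(rmorph1 (@dga_in _ _ Omega)) dga_in_grade0. Qed.

Lemma sqz1_mulE (p q : sqz_dga sqz1) :
  p * q = (p.1 * q.1, p.1 * q.2 + p.2 * s q.1 + coc1 p.1 q.1).
Proof. by []. Qed.

Lemma sqz2_mulE (p q : sqz_dga sqz2) :
  p * q = (p.1 * q.1, lmul2 p.1 q.2 + rmul2 p.2 q.1 + coc2 p.1 q.1).
Proof. by []. Qed.

Lemma sqz1_dE (p : sqz_dga sqz1) : dga_d p = (d p.1, eps1 p.1 + d p.2).
Proof. by []. Qed.

Lemma sqz2_dE (p : sqz_dga sqz2) : dga_d p = (d p.1, eps2 p.1 + d2 p.2).
Proof. by []. Qed.

Definition theta1 : sqz_dga sqz1 := (0, 1).
Definition theta2 : sqz_dga sqz2 := (0, (1, 0)).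

Lemma incl_theta1 x : sqz_incl sqz1 x * theta1 = (0, x).
Proof.
by rewrite sqz1_mulE /= mulr0 mulr1 mul0r addr0 linear0r addr0.
Qed.

Lemma d_theta2 : dga_d theta2 = (0, (0, 1)).
Proof.
by rewrite sqz2_dE /= /d2 /= d1 s1 !linear0 addr0 add0r.
Qed.

Lemma incl_theta2 x : sqz_incl sqz2 x * theta2 = (0, (x, 0)).
Proof.
by rewrite sqz2_mulE /= mulr0 /lmul2 mulr1 mulr0 linear0l linear0r !addr0.
Qed.

Lemma incl_dtheta2 x : sqz_incl sqz2 x * dga_d theta2 = (0, (0, x)).
Proof.
by rewrite d_theta2 sqz2_mulE /= mulr0 /lmul2 mulr1 mulr0 linear0l linear0r !addr0.
Qed.

Lemma eps1E m x : x \in g m ->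
  eps1 x = - ((c * (-1) ^+ m) *: laplacian delta x).
Proof.
move=> gx; rewrite /eps1 (sE gx) /laplacian !(linearZ_LR delta, linearZ_LR d) /=.
by rewrite -scalerDr scalerA.
Qed.

Lemma coc1E m n x y : x \in g m -> y \in g n ->
  coc1 x y = (c * (-1) ^+ (m + n)) *: bracket (fun w : Omega => delta w)
    (fun w y : Omega => perp w y) m x y.
Proof. by move=> gx gy; rewrite /coc1 (sbrE gx gy) scalerA. Qed.

Variable lambda : k.
Hypothesis cE : lambda / 2 = c.

Local Notation Delta := (laplacian (fun w : Omega => delta w)).
Local Notation br :=
  (bracket (fun w : Omega => delta w) (fun w y : Omega => perp w y)).

Lemma sqz1_central : central_extension lambda br Delta
  (sqz_incl sqz1 : {linear Omega -> sqz_dga sqz1}) theta1.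
Proof.
split; rewrite ?cE.
- exact: sqz_incl_deg.
- by [].
- by apply/andP; split; [apply: (graded0 gr) | exact: one_grade0].
- exists id => [[x u]|[x u]]; rewrite incl_theta1; congr pair;
    by rewrite /= ?addr0 ?add0r.
- by rewrite sqz1_mulE /= linear0 linear0l !mul0r !mulr0 !addr0.
- move=> m w gw; rewrite incl_theta1 sqz1_mulE /= !mul0r mul1r linear0l.
  by rewrite addr0 add0r (sE gw); congr pair; rewrite scaler0.
- by rewrite sqz1_dE /= d1 !linear0 addr0.
- move=> m n w y gw gy; rewrite !incl_theta1 sqz1_mulE /=.
  rewrite (coc1E gw gy) mulr0 mul0r !add0r.
  by congr pair; rewrite /= ?scaler0 ?addr0 ?add0r.
- move=> m w gw; rewrite incl_theta1 sqz1_dE /= (eps1E gw) linear0 addr0.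
  by congr pair; rewrite /= ?scaler0 ?oppr0 ?addr0 ?add0r.
Qed.

Lemma sqz2_double : double_extension lambda br Delta (fun w : Omega => delta w)
  (fun w y : Omega => perp w y)
  (sqz_incl sqz2 : {linear Omega -> sqz_dga sqz2}) theta2.
Proof.
split; rewrite ?cE.
- exact: sqz_incl_deg.
- by [].
- apply/andP; split; first exact: (graded0 gr).
  by apply/andP; split=> /=; [exact: one_grade0|rewrite inE].
(* The inverse only reassociates: the model nests its pairs to the right, the axiom to the left. *)
- exists (fun p => (p.1, p.2.1, p.2.2)) => [[[x u] v]|[x [u v]]];
    rewrite incl_theta2 incl_dtheta2.
    by congr (_, _, _); rewrite /= !(addr0, add0r).
  by congr pair; last congr pair; rewrite /= !(addr0, add0r).
- by rewrite sqz2_mulE /= !linear0l linear0r !mul0r !addr0.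
- by rewrite d_theta2 sqz2_mulE /= !linear0l linear0r !mul0r !addr0.
- by rewrite d_theta2 sqz2_mulE /= !linear0l linear0r !mul0r !addr0.
- by rewrite d_theta2 sqz2_mulE /= !linear0l linear0r !mul0r !addr0.
- exact: dga_dd.
- move=> m w gw; rewrite incl_theta2 sqz2_mulE /= mul0r !linear0l.
  rewrite /rmul2 /= !mul0r mul1r !addr0 ?add0r (sE gw).
  by congr pair; last congr pair; rewrite /= ?scaler0.
- move=> w; rewrite incl_dtheta2 d_theta2 sqz2_mulE /= mul0r !linear0l.
  by rewrite /rmul2 /= !mul0r mul1r !addr0 ?add0r.
- move=> m n w y gw gy; rewrite incl_theta2 incl_dtheta2 sqz2_mulE /=.
  rewrite /coc2 (coc1E gw gy) (sE gw) linearZl_LR scalerA linear0l linear0r !add0r.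
  by congr pair; last congr pair; rewrite /= ?(scaler0, oppr0, addr0, add0r).
- move=> m w gw; rewrite incl_theta2 incl_dtheta2 sqz2_dE /= linear0 addr0.
  rewrite /eps2 (eps1E gw).
  by congr pair; last congr pair; rewrite /= ?(scaler0, oppr0, addr0, add0r).
Qed.

(** Each operation of [sqz2] has the corresponding operation of [sqz1] as its [theta'] component by
    definition, so compatibility holds by conversion. *)
Definition forget_dtheta (p : sqz_dga sqz2) : sqz_dga sqz1 := (p.1, p.2.1).

Let forget_dtheta_linear : linear forget_dtheta. Proof. by []. Qed.
Let forget_dtheta_multiplicative : monoid_morphism forget_dtheta.
Proof. by []. Qed.

HB.instance Definition _ := GRing.isLinear.Build
  k (sqz_dga sqz2) (sqz_dga sqz1) _ forget_dtheta forget_dtheta_linear.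
HB.instance Definition _ := GRing.isMonoidMorphism.Build
  (sqz_dga sqz2) (sqz_dga sqz1) forget_dtheta forget_dtheta_multiplicative.

Lemma forget_dtheta_surjection : dga_surjection forget_dtheta.
Proof.
split; last by move=> [x u]; exists (x, (u, 0)).
by split=> // n p /andP[p1 /andP[p2 _]]; apply/andP.
Qed.

(** * Uniqueness of the central extension up to isomorphism *)

Section CentralExtensionUnique.
Variables (E : dga A) (iota : {linear Omega -> E}) (theta : E).
Hypothesis EP : central_extension lambda br Delta iota theta.

(** The axioms determine product and differential on such sums; this is the isomorphism from the
    model to an arbitrary central extension. *)
Definition central_map (p : sqz_dga sqz1) : E := iota p.1 + iota p.2 * theta.

Lemma iotaM x y : iota x * iota y = iota (x * y) + iota (coc1 x y) * theta.
Proof.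
elim/(graded_ind gr): x => [x x' h h'|m x gx].
  rewrite linearD mulrDl h h' linearDl mulrDl !linearD /= mulrDl.
  by zmod.
elim/(graded_ind gr): y => [y y' h h'|n y gy].
  rewrite linearD mulrDr h h' linearDr mulrDr !linearD /= mulrDl.
  by zmod.
by rewrite (ce_mul EP gx gy) cE (coc1E gx gy) linearZ -scalerAl.
Qed.

Lemma thetaM x : theta * iota x = iota (s x) * theta.
Proof.
elim/(graded_ind gr): x => [x y h h'|n x gx].
  by rewrite !linearD /= mulrDr mulrDl h h'.
by rewrite (ce_theta_comm EP gx) (sE gx) linearZ -scalerAl.
Qed.

Lemma d_iota x : dga_d (iota x) = iota (d x) + iota (eps1 x) * theta.
Proof.
elim/(graded_ind gr): x => [x y h h'|n x gx].
  by rewrite !linearD /= h h' mulrDl; zmod.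
rewrite (ce_d EP gx) cE (eps1E gx) (linearN iota) (linearZ_LR iota).
by rewrite mulNr -scalerAl.
Qed.

Lemma d_iota_theta x : dga_d (iota x * theta) = iota (d x) * theta.
Proof.
elim/(graded_ind gr): x => [x y h h'|n x gx].
  by rewrite !(linearD, mulrDl) /= h h'.
rewrite (dga_leibniz _ (ce_deg EP gx)) (ce_d_theta EP) mulr0 scaler0 addr0.
by rewrite d_iota mulrDl -mulrA (ce_theta_sq EP) mulr0 addr0.
Qed.

Let central_map_linear : linear central_map.
Proof.
move=> a p q; rewrite /central_map !(linearP iota) /= mulrDl -scalerAl.
by rewrite scalerDr; zmod.
Qed.

Let central_map_multiplicative : monoid_morphism central_map.
Proof.
split=> [|[x u] [y v]].
  rewrite /central_map /= linear0 mul0r addr0 -(rmorph1 (@dga_in _ _ Omega)).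
  by rewrite (ce_in EP) rmorph1.
rewrite /central_map sqz1_mulE /= !(mulrDl, mulrDr, linearD) /=.
(* All factors [theta] are moved to the right, where a repeated one vanishes. *)
have thetaK (z : E) : z * theta * theta = 0.
  by rewrite -mulrA (ce_theta_sq EP) mulr0.
have thetaMr (z : E) w : z * theta * iota w = z * iota (s w) * theta.
  by rewrite -mulrA thetaM mulrA.
rewrite !mulrA !thetaMr !iotaM !mulrDl !thetaK.
by zmod.
Qed.

HB.instance Definition _ := GRing.isLinear.Build
  k (sqz_dga sqz1) E _ central_map central_map_linear.
HB.instance Definition _ := GRing.isMonoidMorphism.Build
  (sqz_dga sqz1) E central_map central_map_multiplicative.

Lemma central_map_morphism : dga_morphism central_map.
Proof.
split=> [n [x u] /andP[/= gx gu]|a|[x u]].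
- apply: (gradedD (dga_graded E)); first exact: (ce_deg EP gx).
  (* In degree 0 the coefficient of [theta] is zero; otherwise [theta] supplies the missing degree
     1. *)
  case: n gu {gx} => [/eqP->|n gu].
    by rewrite linear0 mul0r (graded0 (dga_graded E)).
  by rewrite -addn1; apply: grade_mul (ce_deg EP gu) (ce_theta_deg EP).
- rewrite -(ce_in EP); change (iota (dga_in a) + iota 0 * theta = iota (dga_in a)).
  by rewrite linear0 mul0r addr0.
- rewrite sqz1_dE /= /central_map /= !linearD /= d_iota d_iota_theta mulrDl.
  by zmod.
Qed.

Lemma central_map_inverse : exists h : {lrmorphism E -> sqz_dga sqz1},
  cancel central_map h /\ cancel h central_map.
Proof.
have [h fK hK] := ce_bij EP.
(* The inverse from [ce_bij] lands in plain pairs; retyping gives its target the structure of the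
   model. *)
pose h' : E -> sqz_dga sqz1 := h.
have fK' : cancel central_map h' by exact: fK.
have hK' : cancel h' central_map by exact: hK.
pose hl : {lrmorphism E -> sqz_dga sqz1} := HB.pack h'
  (GRing.isLinear.Build _ _ _ _ h' (can2_linear fK' hK'))
  (GRing.isMonoidMorphism.Build _ _ h' (can2_monoid_morphism fK' hK')).
by exists hl.
Qed.

(** The maps between the models are transported along the isomorphism: [pi2] forgets [dtheta'] and
    then applies it, [pi1] applies its inverse and then projects. *)
Lemma central_extension_tower :
  exists (pi2 : {lrmorphism sqz_dga sqz2 -> E}) (pi1 : {lrmorphism E -> Omega}),
  [/\ dga_surjection pi2,
      (forall w : Omega, pi2 (sqz_incl sqz2 w) = iota w)
        /\ pi2 theta2 = theta /\ pi2 (dga_d theta2) = 0,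
      dga_surjection pi1
    & (forall w : Omega, pi1 (iota w) = w) /\ pi1 theta = 0].
Proof.
have [h [fK hK]] := central_map_inverse.
have [fsurj hsurj] := dga_iso_inv fK hK central_map_morphism.
have f_incl w : central_map (sqz_incl sqz1 w) = iota w.
  by rewrite /central_map /= linear0 mul0r addr0.
have f_theta : central_map theta1 = theta.
  rewrite /central_map /= linear0 add0r -(rmorph1 (@dga_in _ _ Omega)).
  by rewrite (ce_in EP) rmorph1 mul1r.
exists (central_map \o forget_dtheta), (@sqz_fst _ _ _ _ sqz1 \o h).
split.
- exact: dga_surjection_comp fsurj forget_dtheta_surjection.
- split=> [w|]; first exact: f_incl.
  split; first exact: f_theta.
  by rewrite d_theta2 /= /central_map /= !linear0 mul0r addr0.
- exact: dga_surjection_comp (sqz_fst_surjection sqz1) hsurj.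
- by split=> [w|]; rewrite /= -?f_incl -?f_theta fK.
Qed.

End CentralExtensionUnique.

End Cocycles.

Theorem proposition3p21 (k : fieldType) (hk : 2%N \notin [pchar k])
    (A : algType k) (Omega : dga A) (hstd : standard Omega)
    (lambda : k) (hlambda : lambda != 0)
    (perp : {bilinear Omega -> Omega -> Omega})
    (hperp_deg : has_degree2 (-2) (fun w y : Omega => perp w y))
    (hperp0 : forall (a : A) (w : Omega),
       perp w (dga_in a) = 0 /\ perp (dga_in a) w = 0)
    (hperp : forall (m n p : nat) (w y z : Omega),
       w \in grade Omega m -> y \in grade Omega n -> z \in grade Omega p ->
       (-1) ^+ n *: perp (w * y) z + perp w y * z
       = perp w (y * z) + (-1) ^+ (m + n) *: (w * perp y z))
    (delta : {linear Omega -> Omega}) (hreg : regular delta)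
    (hdelta : forall (a : A) (w : Omega),
       delta (dga_in a * w) - dga_in a * delta w
       = perp (dga_d (dga_in a)) w) :
  let Delta := laplacian (fun w : Omega => delta w) in
  let br := bracket (fun w : Omega => delta w)
              (fun w y : Omega => perp w y) in
  (exists (Omega1 : dga A) (iota1 : {linear Omega -> Omega1})
          (theta1 : Omega1),
     central_extension lambda br Delta iota1 theta1) /\
  (forall (Omega1 : dga A) (iota1 : {linear Omega -> Omega1})
          (theta1 : Omega1),
     central_extension lambda br Delta iota1 theta1 ->
     exists (Omega2 : dga A) (iota2 : {linear Omega -> Omega2})
            (theta2 : Omega2),
       double_extension lambda br Delta (fun w : Omega => delta w)
         (fun w y : Omega => perp w y) iota2 theta2 /\
       exists (pi2 : {lrmorphism Omega2 -> Omega1})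
              (pi1 : {lrmorphism Omega1 -> Omega}),
         [/\ dga_surjection pi2,
             (forall w : Omega, pi2 (iota2 w) = iota1 w)
               /\ pi2 theta2 = theta1 /\ pi2 (dga_d theta2) = 0,
             dga_surjection pi1
           & (forall w : Omega, pi1 (iota1 w) = w) /\ pi1 theta1 = 0]).
Proof.
have [s sE] := parity_exists (dga_graded Omega).
have delta_deg := hreg.1.
have cE : lambda / 2 = lambda / 2 by [].
split.
  by do 3 eexists; apply: (sqz1_central sE hperp_deg hperp0 hperp delta_deg cE).
move=> Omega1 iota1 theta1 H1.
have [pi2 [pi1 piP]] :=
  central_extension_tower sE hperp_deg hperp0 hperp delta_deg cE H1.
(* The double extension is the same model for every [Omega1]; only the maps of the tower depend on
   [Omega1]. *)
do 3 eexists; split.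
  exact: (sqz2_double sE hperp_deg hperp0 hperp delta_deg cE).
by exists pi2, pi1.
Qed.
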